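(* Let $F,G\in\mathcal{F}$ and let $n\ge1$ be an integer. (a) If $F\in\mathcal{J}$, then $\overline{F}\asymp\overline{F^{n*}}$ and hence $F^{n*}\in\mathcal{J}$. (b) If $F\in\mathcal{J}$ and $\overline{F}\asymp\overline{G}$, then $F*G\in\mathcal{J}$. (c) If $F^{n*}\in\mathcal{J}$, then $\overline{F}\asymp\overline{F^{n*}}$ and hence $F\in\mathcal{J}$.
   Context: Let $\mathcal{F}$ be the set of all distribution functions of nonnegative random variables with unbounded support, and write $\overline{F}=1-F$. $F*G$ denotes convolution and $F^{n*}$ the $n$-fold convolution of $F$ with itself ($F^{1*}=F$). For positive functions $f,g$ on $[0,\infty)$, $f\asymp g$ means $0<\liminf_{x\to\infty}f(x)/g(x)\le\limsup_{x\to\infty}f(x)/g(x)<\infty$. The class $\mathcal{J}$ is the set of all $F\in\mathcal{F}$ such that, for $X_1,X_2,\ldots$ i.i.d. with distribution function $F$ and for all $m\ge2$, $$\lim_{K\to\infty}\liminf_{x\to\infty}\frac{\mathbb{P}(\max(X_1,\ldots,X_m)>x-K,\;X_1+\cdots+X_m>x)}{\mathbb{P}(X_1+\cdots+X_m>x)}=1.$$ *)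

(* Defs.v *)
From HB Require Import structures.
From mathcomp Require Import all_boot all_order all_algebra.
From mathcomp Require Import all_classical all_reals all_analysis.

Set Implicit Arguments.
Unset Strict Implicit.
Unset Printing Implicit Defensive.

Import Order.TTheory GRing.Theory Num.Theory.
Import numFieldNormedType.Exports.

Local Open Scope classical_set_scope.
Local Open Scope ring_scope.

(* A distribution function on the real line is an F : distrFun R, that is, a
   nondecreasing right-continuous function with limits 0 at -oo and 1 at +oo. *)
Notation distrFun R := (cumulativeBounded (0 : R) (1 : R)).

Definition df_law (R : realType) (F : distrFun R) :
    probability (measurableTypeR R) R :=
  lebesgue_stieltjes_measure F.

Definition cdf_of (R : realType) (P : probability (measurableTypeR R) R) :
  R -> R := fun x => fine (P `]-oo, x]%classic).

Section cdf_of_theory.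
Context (R : realType) (P : probability (measurableTypeR R) R).

Let idR : measurableTypeR R -> R := idfun.

#[local] HB.instance Definition _ :=
  @isMeasurableFun.Build _ _ _ _ idR (@measurable_id _ _ setT).

Let cdf_ofE : cdf_of P = fine \o cdf (idR : {RV P >-> R}).
Proof. by []. Qed.

Lemma cdf_of_nondecreasing : nondecreasing (cdf_of P).
Proof.
by move=> x y xy; rewrite cdf_ofE /= fine_le ?fin_num_measure// cdf_nondecreasing.
Qed.

Lemma cdf_of_right_continuous : right_continuous (cdf_of P).
Proof.
move=> a; rewrite cdf_ofE; apply: fine_cvg.
by rewrite fineK ?fin_num_measure//; exact: cdf_right_continuous.
Qed.

HB.instance Definition _ := isCumulative.Build R _ R (cdf_of P)
  cdf_of_nondecreasing cdf_of_right_continuous.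

Lemma cvg_cdf_ofNy : cdf_of P @ -oo --> (0 : R).
Proof. by rewrite cdf_ofE; exact/fine_cvg/cvg_cdfNy0. Qed.

Lemma cvg_cdf_ofy : cdf_of P @ +oo --> (1 : R).
Proof. by rewrite cdf_ofE; exact/fine_cvg/cvg_cdfy1. Qed.

HB.instance Definition _ := isCumulativeBounded.Build R 0 1 (cdf_of P)
  cvg_cdf_ofNy cvg_cdf_ofy.

End cdf_of_theory.

Definition addRR (R : realType) (z : measurableTypeR R * measurableTypeR R) :
  measurableTypeR R := (z.1 + z.2 : R).

Lemma measurable_addRR (R : realType) : measurable_fun setT (@addRR R).
Proof.
exact: (measurable_realfun.measurable_funD (@measurable_fst _ _ _ _) (@measurable_snd _ _ _ _)).
Qed.

HB.instance Definition _ (R : realType) :=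
  isMeasurableFun.Build _ _ _ _ (@addRR R) (@measurable_addRR R).

Definition convolution (R : realType) (F G : distrFun R) : distrFun R :=
  cdf_of (distribution (df_law F \x df_law G)%E (@addRR R)).

(* [nconvolution F n] is the n-fold convolution of F with itself for n >= 1;
   [nconvolution F 0] is the junk value F. *)
Definition nconvolution (R : realType) (F : distrFun R) (n : nat) : distrFun R :=
  iter n.-1 (convolution F) F.

Definition survival (R : realType) (F : distrFun R) (x : R) : R := 1 - F x.

Definition nonneg_unbounded (R : realType) (F : distrFun R) : Prop :=
  df_law F `]-oo, 0[%classic = 0%E /\
  (forall x : R, (0%E < df_law F `]x, +oo[%classic)%E).

Definition asymp (R : realType) (f g : R -> R) : Prop :=
  (0 < limf_einf (fun x => (f x / g x)%:E) +oo%R)%E /\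
  (limf_esup (fun x => (f x / g x)%:E) +oo%R < +oo)%E.

(* In the product rule some of the A i may be setT, so that it covers every
   subfamily of the X i. *)
Definition mutually_independent (R : realType) d (T : measurableType d)
    (P : probability T R) (m : nat) (X : 'I_m -> {RV P >-> R}) : Prop :=
  forall A : 'I_m -> set R, (forall i, measurable (A i)) ->
    (P (\bigcap_i (X i @^-1` A i)) = \prod_(i < m) P (X i @^-1` A i))%E.

Definition iid (R : realType) d (T : measurableType d)
    (P : probability T R) (m : nat) (X : 'I_m -> {RV P >-> R})
    (F : distrFun R) : Prop :=
  (forall i x, cdf (X i) x = (F x)%:E) /\ mutually_independent X.

Definition big_jump_ratio (R : realType) d (T : measurableType d)
    (P : probability T R) (m : nat) (X : 'I_m -> {RV P >-> R}) (K x : R) : R :=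
  fine (P [set t | ((x - K)%:E < \big[maxe/-oo]_(i < m) (X i t)%:E)%E /\
                   x < \sum_(i < m) X i t]) /
  fine (P [set t | x < \sum_(i < m) X i t]).

(* Only X_1, ..., X_m enter the condition for a given m, so finite i.i.d.
   families, on arbitrary probability spaces, are quantified over in place of
   an infinite sequence. *)
Definition classJ (R : realType) (F : distrFun R) : Prop :=
  nonneg_unbounded F /\
  forall m : nat, (2 <= m)%N ->
  forall d (T : measurableType d) (P : probability T R)
    (X : 'I_m -> {RV P >-> R}), iid X F ->
  limf_einf (fun x => (big_jump_ratio X K x)%:E) +oo%R @[K --> +oo%R]
    --> 1%:E.

(* Main.v *)
From HB Require Import structures.
Require Import Defs.
From mathcomp Require Import all_boot all_order all_algebra.
From mathcomp Require Import all_classical all_reals all_analysis.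
From mathcomp Require Import ring lra.

(** The class J is governed by the excess of two independent variables X ~ F and
    Y ~ G, the probability that X > K, Y > K and X + Y > x. Say that F has
    negligible excess when, for X and Y both distributed as F, it is at most
    eps P(X > x) for every eps > 0, some K, and all large x. The proof shows that
    F is in J if and only if it has negligible excess
    ([classJ_negligible_excess], [negligible_excess_classJ]).

    The advantage of this criterion is monotonicity. Conditioning on one of the
    variables turns the excess into a mixture of tails of the other, so if the
    tails of F and G are at most constant multiples of those of F' and G', the
    same holds for the excesses ([excess_tail_le]). Negligible excess is
    therefore invariant under tail equivalence ([negligible_excess_equiv]), and
    each of the three claims reduces to a comparison of tails.

    The comparisons rest on the remark that, if neither X nor Y exceeds x - K
    while X + Y > x, then both exceed K ([survival_convolution_split]). Hence the
    tail of F * G at x is at most the sum of the two tails at x - K and the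
    excess. When F has negligible excess, this bounds the tail of F * F by a
    multiple of P(X > x - K), and the elementary lower bound
    P(X > a) P(Y > b) <= P(X + Y > a + b) then shows that shifting x changes the
    tail by a constant factor only. So the tails O(P(X > x)) are closed under
    convolution ([tail_le_convolution_closed]), which settles the passage to
    convolution powers and to F * G, since the tail of a sum of nonnegative
    variables is at least that of a summand. For convolution roots, the tail of
    H, the n-th power of F, is bounded by that of F by peeling off one summand at
    a time and absorbing the errors, which are small multiples of the tail of H
    ([nconvolution_root_tail_le]).

    Passing from two variables to m reduces to two again: if the sum of
    X_1, ..., X_m is large without a big jump, some X_i and the sum of the others
    are both large, and these two are independent ([iid_split]). *)

Set Implicit Arguments.
Unset Strict Implicit.
Unset Printing Implicit Defensive.

Import Order.TTheory GRing.Theory Num.Theory.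
Import numFieldNormedType.Exports.

Local Open Scope classical_set_scope.
Local Open Scope ring_scope.

(** * Probabilities and laws of distribution functions *)

(** Real-valued probabilities keep the tail estimates inside an ordered field,
    where linear arithmetic applies. Locked, as is [law2] below, so that
    comparing two probabilities never unfolds the measures. *)
HB.lock Definition prob (R : realType) d (T : measurableType d) (P : probability T R)
  (A : set T) : R := fine (P A).

Section prob_theory.
Context (R : realType) d (T : measurableType d) (P : probability T R).
Implicit Types A B : set T.

Lemma probE A : measurable A -> (prob P A)%:E = P A.
Proof. by move=> mA; rewrite prob.unlock fineK// fin_num_measure. Qed.

Lemma prob_ge0 A : 0 <= prob P A.
Proof. by rewrite prob.unlock; exact/fine_ge0/measure_ge0. Qed.

Lemma le_prob A B : measurable A -> measurable B -> A `<=` B ->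
  prob P A <= prob P B.
Proof.
move=> mA mB AB; rewrite -lee_fin !probE//.
by apply: le_measure => //; rewrite inE.
Qed.

Lemma prob_le1 A : measurable A -> prob P A <= 1.
Proof. by move=> mA; rewrite -lee_fin probE// probability_le1. Qed.

Lemma prob_setT : prob P setT = 1.
Proof. by rewrite prob.unlock probability_setT. Qed.

Lemma prob_setC A : measurable A -> prob P (~` A) = 1 - prob P A.
Proof.
move=> mA; apply: EFin_inj; rewrite EFinB !probE//; last exact: measurableC.
exact: probability_setC.
Qed.

Lemma prob_setU_le A B : measurable A -> measurable B ->
  prob P (A `|` B) <= prob P A + prob P B.
Proof.
move=> mA mB; rewrite -lee_fin EFinD !probE//; last exact: measurableU.
exact: measureU2.
Qed.

Lemma prob_setDI A B : measurable A -> measurable B ->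
  prob P A = prob P (A `&` B) + prob P (A `\` B).
Proof.
move=> mA mB; apply: EFin_inj; rewrite EFinD !probE//; last 2 first.
- exact: measurableD.
- exact: measurableI.
by rewrite addeC; exact: measureDI.
Qed.

Lemma prob_bigsetU_le (I : Type) (s : seq I) (A : I -> set T) :
  (forall i, measurable (A i)) ->
  prob P (\big[setU/set0]_(i <- s) A i) <= \sum_(i <- s) prob P (A i).
Proof.
move=> mA; elim: s => [|i s IH].
  by rewrite !big_nil prob.unlock measure0.
rewrite !big_cons; apply: le_trans (lerD (lexx _) IH).
by apply: prob_setU_le => //; exact: bigsetU_measurable.
Qed.

End prob_theory.

(** The joint law of independent X ~ F and Y ~ G. *)
HB.lock Definition law2 (R : realType) (F G : distrFun R) :
    probability (measurableTypeR R * measurableTypeR R)%type R :=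
  (df_law F \x df_law G)%E.

Section df_law_theory.
Context (R : realType).
Implicit Types (F G : distrFun R).

Lemma df_law_itvNyc F (x : R) : df_law F `]-oo, x]%classic = (F x)%:E.
Proof. by rewrite -cdf_lebesgue_stieltjes_id. Qed.

(** The half-lines ]-oo, x] determine the half-open intervals by difference, and
    these determine a Borel measure. This identifies both the law of a sum and
    the law of each [X i] with Stieltjes measures. *)
Lemma df_law_unique F (P : probability (measurableTypeR R) R) :
  (forall x, P `]-oo, x]%classic = (F x)%:E) ->
  forall A, measurable A -> df_law F A = P A.
Proof.
move=> PF A mA; apply: lebesgue_stieltjes_measure_unique => // _ [[a b] _ <-].
rewrite -[LHS]/(df_law F `]a, b]%classic) /=.
have [ab|ba] := leP a b; last first.
  by rewrite set_itv_ge ?measure0// bnd_simp -leNgt ltW.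
have -> : `]a, b]%classic = `]-oo, b]%classic `\` `]-oo, a]%classic :> set R.
  by rewrite -[RHS]setCK setCD setCitvl setUC -[LHS]setCK setCitv.
have sub : `]-oo, b]%classic `&` `]-oo, a]%classic = `]-oo, a]%classic :> set R.
  apply/setIidr => x /=; rewrite !in_itv/= => xa; exact: le_trans xa ab.
rewrite !measureD ?sub//; last 2 first.
- by rewrite ltey_eq fin_num_measure.
- by rewrite ltey_eq fin_num_measure.
by congr (_ - _)%E; [rewrite [RHS]PF|rewrite [RHS]PF]; exact: df_law_itvNyc.
Qed.

Lemma survivalE F x : survival F x = prob (df_law F) `]x, +oo[%classic.
Proof.
by rewrite -setCitvl prob_setC// prob.unlock df_law_itvNyc.
Qed.

Lemma df_law_survival F x : df_law F `]x, +oo[%classic = (survival F x)%:E.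
Proof. by rewrite survivalE probE. Qed.

Lemma survival_ge0 F x : 0 <= survival F x.
Proof. by rewrite survivalE prob_ge0. Qed.

Lemma survival_le1 F x : survival F x <= 1.
Proof. by rewrite survivalE prob_le1. Qed.

Lemma survival_le F x y : x <= y -> survival F y <= survival F x.
Proof.
move=> xy; rewrite !survivalE le_prob// => z /=.
by rewrite !in_itv/= !andbT; exact: le_lt_trans.
Qed.

Lemma survival_gt0 F x : nonneg_unbounded F -> 0 < survival F x.
Proof. by case=> _ /(_ x); rewrite df_law_survival lte_fin. Qed.



Lemma measurable_fst_gt (a : R) :
  measurable [set z : measurableTypeR R * measurableTypeR R | a < z.1].
Proof.
rewrite [X in measurable X](_ : _ = `]a, +oo[%classic `*` setT); last first.
  by apply/seteqP; split => z /=; rewrite in_itv/= andbT // => -[].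
exact: measurableX.
Qed.

Lemma measurable_snd_gt (a : R) :
  measurable [set z : measurableTypeR R * measurableTypeR R | a < z.2].
Proof.
rewrite [X in measurable X](_ : _ = setT `*` `]a, +oo[%classic); last first.
  by apply/seteqP; split => z /=; rewrite in_itv/= andbT // => -[].
exact: measurableX.
Qed.

Lemma measurable_add_gt (a : R) :
  measurable [set z : measurableTypeR R * measurableTypeR R | a < z.1 + z.2].
Proof.
have := @measurable_addRR R measurableT `]a, +oo[%classic (measurable_itv _).
rewrite setTI; congr (measurable _); apply/seteqP; split => z /=;
  by rewrite /addRR in_itv/= andbT.
Qed.

Lemma law2XE F G (A B : set (measurableTypeR R)) :
  measurable A -> measurable B ->
  law2 F G (A `*` B) = (df_law F A * df_law G B)%E.
Proof. by move=> mA mB; rewrite law2.unlock; exact: product_measure1E. Qed.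

Lemma law2X F G (A B : set (measurableTypeR R)) :
  measurable A -> measurable B ->
  prob (law2 F G) (A `*` B) = prob (df_law F) A * prob (df_law G) B.
Proof.
move=> mA mB; apply: EFin_inj; rewrite EFinM !probE//; last exact: measurableX.
exact: law2XE.
Qed.

Lemma law2_fst_gt F G x :
  prob (law2 F G) [set z | x < z.1] = survival F x.
Proof.
rewrite [X in prob _ X](_ : _ = `]x, +oo[%classic `*` setT); last first.
  by apply/seteqP; split => z /=; rewrite in_itv/= andbT // => -[].
by rewrite law2X// prob_setT mulr1 survivalE.
Qed.

Lemma law2_snd_gt F G x :
  prob (law2 F G) [set z | x < z.2] = survival G x.
Proof.
rewrite [X in prob _ X](_ : _ = setT `*` `]x, +oo[%classic); last first.
  by apply/seteqP; split => z /=; rewrite in_itv/= andbT // => -[].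
by rewrite law2X// prob_setT mul1r survivalE.
Qed.

Lemma df_law_convolution F G (A : set R) : measurable A ->
  df_law (convolution F G) A = law2 F G (@addRR R @^-1` A).
Proof.
move=> mA; apply: (@df_law_unique _ (distribution (law2 F G) (@addRR R))) => // x.
by rewrite law2.unlock /convolution /= /cdf_of fineK// fin_num_measure.
Qed.

Lemma law2_xsectionE F G (A : set (measurableTypeR R * measurableTypeR R)) :
  law2 F G A = (\int[df_law F]_x df_law G (xsection A x))%E.
Proof. by rewrite law2.unlock. Qed.

Lemma law2_ysectionE F G (A : set (measurableTypeR R * measurableTypeR R)) :
  measurable A -> law2 F G A = (\int[df_law G]_y df_law F (ysection A y))%E.
Proof.
move=> mA; rewrite law2.unlock -[LHS]/((df_law F \x df_law G)%E A).
rewrite -[RHS]/((df_law F \x^ df_law G)%E A).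
have uniq := @product_measure_unique _ _ _ _ _ (df_law F) (df_law G)
  (df_law F \x^ df_law G)%E.
by apply: (uniq _ A) => // B D mB mD; exact: product_measure2E.
Qed.

Lemma survival_convolution F G x :
  survival (convolution F G) x = prob (law2 F G) [set z | x < z.1 + z.2].
Proof.
rewrite survivalE prob.unlock (df_law_convolution F G (measurable_itv `]x, +oo[)).
congr (fine (law2 F G _)).
by apply/seteqP; split => z /=; rewrite /addRR in_itv/= andbT.
Qed.

End df_law_theory.

(** * Tails and excesses of sums of two independent variables *)

Section tails.
Context (R : realType).
Implicit Types (F G H : distrFun R).

(** Stochastic domination up to a constant transfers to any planar event whose
    sections are open upper half-lines: conditionally on the second coordinate,
    the event is that X exceeds a level, and Fubini integrates the inequality
    between tails. *)
Lemma law2_le_l F F' G (C : R) (A : set (measurableTypeR R * measurableTypeR R)) :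
  0 <= C -> measurable A ->
  (forall x, survival F x <= C * survival F' x) ->
  (forall y, ysection A y = set0 \/ exists a, ysection A y = `]a, +oo[%classic) ->
  prob (law2 F G) A <= C * prob (law2 F' G) A.
Proof.
move=> C0 mA FF' sA; rewrite -lee_fin EFinM !(probE _ mA).
rewrite (law2_ysectionE F G mA) (law2_ysectionE F' G mA).
have mf F1 := measurable_fun_ysection (df_law F1) mA.
rewrite -ge0_integralZl//; last exact: mf.
apply: ge0_le_integral => //; [exact: mf|by apply: measurable_funeM; exact: mf|].
move=> y _; case: (sA y) => [->|[a ->]]; first by rewrite !measure0 mule0.
by rewrite !df_law_survival -EFinM lee_fin.
Qed.

Lemma law2_le_r F G G' (C : R) (A : set (measurableTypeR R * measurableTypeR R)) :
  0 <= C -> measurable A ->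
  (forall x, survival G x <= C * survival G' x) ->
  (forall y, xsection A y = set0 \/ exists a, xsection A y = `]a, +oo[%classic) ->
  prob (law2 F G) A <= C * prob (law2 F G') A.
Proof.
move=> C0 mA GG' sA; rewrite -lee_fin EFinM !(probE _ mA).
rewrite (law2_xsectionE F G) (law2_xsectionE F G').
have mf F1 := measurable_fun_xsection (df_law F1) mA.
rewrite -ge0_integralZl//; last exact: mf.
apply: ge0_le_integral => //; [exact: mf|by apply: measurable_funeM; exact: mf|].
move=> y _; case: (sA y) => [->|[a ->]]; first by rewrite !measure0 mule0.
by rewrite !df_law_survival -EFinM lee_fin.
Qed.

Lemma survival_convolution_le_l F F' G (C : R) : 0 <= C ->
  (forall x, survival F x <= C * survival F' x) ->
  forall x, survival (convolution F G) x <= C * survival (convolution F' G) x.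
Proof.
move=> C0 FF' x; rewrite [leLHS]survival_convolution.
rewrite [X in _ <= _ * X]survival_convolution.
apply: law2_le_l => //; first exact: measurable_add_gt.
move=> y; right; exists (x - y); apply/seteqP.
by split => z /=; rewrite /ysection/= inE/= in_itv/= andbT ltrBlDr.
Qed.

Lemma survival_convolution_le_r F G G' (C : R) : 0 <= C ->
  (forall x, survival G x <= C * survival G' x) ->
  forall x, survival (convolution F G) x <= C * survival (convolution F G') x.
Proof.
move=> C0 GG' x; rewrite [leLHS]survival_convolution.
rewrite [X in _ <= _ * X]survival_convolution.
apply: law2_le_r => //; first exact: measurable_add_gt.
move=> y; right; exists (x - y); apply/seteqP.
by split => z /=; rewrite /xsection/= inE/= in_itv/= andbT ltrBlDl.
Qed.

(** The way in which X + Y can exceed x without a single big jump being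
    responsible: neither summand is bounded by K. *)
Definition both_big (K x : R) : set (measurableTypeR R * measurableTypeR R) :=
  [set z | [/\ K < z.1, K < z.2 & x < z.1 + z.2]].

Definition excess F G (K x : R) : R := prob (law2 F G) (both_big K x).

Lemma measurable_both_big K x : measurable (both_big K x).
Proof.
rewrite [X in measurable X](_ : _ = [set z | K < z.1] `&`
  ([set z | K < z.2] `&` [set z | x < z.1 + z.2])).
  apply: measurableI; first exact: measurable_fst_gt.
  apply: measurableI; [exact: measurable_snd_gt|exact: measurable_add_gt].
by apply/seteqP; split => z /= => [[]|[? []]].
Qed.

Lemma excess_le_l F F' G (C : R) : 0 <= C ->
  (forall x, survival F x <= C * survival F' x) ->
  forall K x, excess F G K x <= C * excess F' G K x.
Proof.
move=> C0 FF' K x; apply: law2_le_l => //; first exact: measurable_both_big.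
move=> y; have [Ky|yK] := ltP K y; [right|left].
  exists (Num.max K (x - y)); apply/seteqP; split => z;
    rewrite /ysection/= inE/= in_itv/= andbT gt_max ltrBlDr.
  - by move=> [-> _ ->].
  - by move=> /andP[].
apply/seteqP; split => z //; rewrite /ysection/= inE/= => -[_ /=].
by rewrite ltNge yK.
Qed.

Lemma excess_le_r F G G' (C : R) : 0 <= C ->
  (forall x, survival G x <= C * survival G' x) ->
  forall K x, excess F G K x <= C * excess F G' K x.
Proof.
move=> C0 GG' K x; apply: law2_le_r => //; first exact: measurable_both_big.
move=> y; have [Ky|yK] := ltP K y; [right|left].
  exists (Num.max K (x - y)); apply/seteqP; split => z;
    rewrite /xsection/= inE/= in_itv/= andbT gt_max ltrBlDl.
  - by move=> [_ -> ->].
  - by move=> /andP[].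
apply/seteqP; split => z //; rewrite /xsection/= inE/= => -[/=].
by rewrite ltNge yK.
Qed.

Lemma excess_anti F G K K' x : K <= K' -> excess F G K' x <= excess F G K x.
Proof.
move=> KK'; apply: le_prob; try exact: measurable_both_big.
by move=> z /= [? ? ?]; split => //; exact: le_lt_trans KK' _.
Qed.

Lemma measurable_fst_lt0 :
  measurable [set z : measurableTypeR R * measurableTypeR R | z.1 < 0].
Proof.
rewrite [X in measurable X](_ : _ = `]-oo, 0[%classic `*` setT); last first.
  by apply/seteqP; split => z /=; rewrite in_itv/= // => -[].
exact: measurableX.
Qed.

Lemma measurable_snd_lt0 :
  measurable [set z : measurableTypeR R * measurableTypeR R | z.2 < 0].
Proof.
rewrite [X in measurable X](_ : _ = setT `*` `]-oo, 0[%classic); last first.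
  by apply/seteqP; split => z /=; rewrite in_itv/= // => -[].
exact: measurableX.
Qed.

Lemma law2_fst_lt0 F G : nonneg_unbounded F ->
  prob (law2 F G) [set z | z.1 < 0] = 0.
Proof.
move=> [F0 _].
rewrite [X in prob _ X](_ : _ = `]-oo, 0[%classic `*` setT); last first.
  by apply/seteqP; split => z /=; rewrite in_itv/= // => -[].
by rewrite law2X// prob_setT mulr1 prob.unlock F0.
Qed.

Lemma law2_snd_lt0 F G : nonneg_unbounded G ->
  prob (law2 F G) [set z | z.2 < 0] = 0.
Proof.
move=> [G0 _].
rewrite [X in prob _ X](_ : _ = setT `*` `]-oo, 0[%classic); last first.
  by apply/seteqP; split => z /=; rewrite in_itv/= // => -[].
by rewrite law2X// prob_setT mul1r prob.unlock G0.
Qed.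

(** Up to a null set the second summand is nonnegative, so X > x forces
    X + Y > x. *)
Lemma le_survival_convolution_l F G x : nonneg_unbounded G ->
  survival F x <= survival (convolution F G) x.
Proof.
move=> hG; rewrite -(law2_fst_gt F G) survival_convolution.
rewrite -[leRHS]addr0 -(law2_snd_lt0 F hG).
apply: le_trans (prob_setU_le _ (measurable_add_gt _) measurable_snd_lt0).
apply: le_prob; [exact: measurable_fst_gt| |].
  by apply: measurableU; [exact: measurable_add_gt|exact: measurable_snd_lt0].
move=> z /= xz.
by have [?|z20] := ltP z.2 0; [right|left; rewrite ltr_wpDr].
Qed.

Lemma le_survival_convolution_r F G x : nonneg_unbounded F ->
  survival G x <= survival (convolution F G) x.
Proof.
move=> hF; rewrite -(law2_snd_gt F G) survival_convolution.
rewrite -[leRHS]addr0 -(law2_fst_lt0 G hF).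
apply: le_trans (prob_setU_le _ (measurable_add_gt _) measurable_fst_lt0).
apply: le_prob; [exact: measurable_snd_gt| |].
  by apply: measurableU; [exact: measurable_add_gt|exact: measurable_fst_lt0].
move=> z /= xz.
by have [?|z10] := ltP z.1 0; [right|left; rewrite ltr_wpDl].
Qed.

Lemma survivalM_le F G a b :
  survival F a * survival G b <= survival (convolution F G) (a + b).
Proof.
rewrite survival_convolution !survivalE -law2X//.
apply: le_prob; [exact: measurableX|exact: measurable_add_gt|].
by move=> z /=; rewrite !in_itv/= !andbT => -[]; exact: ltrD.
Qed.

(** If neither X nor Y exceeds x - K while X + Y > x, then each exceeds K. *)
Lemma survival_convolution_split F G K x :
  survival (convolution F G) x <=
  survival F (x - K) + survival G (x - K) + excess F G K x.
Proof.
rewrite survival_convolution -(law2_fst_gt F G) -(law2_snd_gt F G).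
have m1 := measurable_fst_gt (x - K); have m2 := measurable_snd_gt (x - K).
have m3 := measurable_both_big K x.
apply: le_trans (lerD (prob_setU_le _ m1 m2) (lexx _)).
apply: le_trans (prob_setU_le _ _ m3); last exact: measurableU.
apply: le_prob; [exact: measurable_add_gt| |].
  by apply: measurableU => //; exact: measurableU.
move=> z /= xz; have [?|z1] := ltP (x - K) z.1; first by left; left.
have [?|z2] := ltP (x - K) z.2; first by left; right.
by right; split => //; lra.
Qed.

Lemma nonneg_unbounded_convolution F G :
  nonneg_unbounded F -> nonneg_unbounded G ->
  nonneg_unbounded (convolution F G).
Proof.
move=> hF hG; split; last first.
  move=> x; rewrite df_law_survival lte_fin.
  exact: lt_le_trans (survival_gt0 x hF) (le_survival_convolution_l _ _ hG).
have mA : measurable (@addRR R @^-1` `]-oo, 0[%classic).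
  by rewrite -[X in measurable X]setTI; apply: measurable_addRR.
rewrite df_law_convolution// -probE//; congr EFin.
apply/eqP; rewrite eq_le prob_ge0 andbT.
rewrite -[leRHS](addr0 0) -[X in _ <= X + _](law2_fst_lt0 G hF).
rewrite -[X in _ <= _ + X](law2_snd_lt0 F hG).
apply: le_trans (prob_setU_le _ measurable_fst_lt0 measurable_snd_lt0).
apply: le_prob => //.
  by apply: measurableU; [exact: measurable_fst_lt0|exact: measurable_snd_lt0].
move=> z /=; rewrite /addRR in_itv/= => z0.
have [z1|z1] := ltP z.1 0; first by left.
by right; lra.
Qed.

End tails.

(** * Negligible excess *)

Section negligible_excess.
Context (R : realType).
Implicit Types (F G H : distrFun R).

Definition tail_le F G :=
  exists2 C : R, 0 < C & forall x, survival F x <= C * survival G x.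

(** The analytic form of membership in the class J. It involves two independent
    copies only and compares with the tail of F instead of that of the sum,
    which makes it visibly stable under tail equivalence. *)
Definition negligible_excess F := forall eps : R, 0 < eps ->
  exists K x0 : R, forall x, x0 <= x -> excess F F K x <= eps * survival F x.

(** An asymptotic bound is a global one with a larger constant: to the left of
    x0 the tail of G is at least its positive value at x0, and f is at most 1. *)
Lemma eventually_tail_le (f : R -> R) G (C x0 : R) : nonneg_unbounded G ->
  0 <= C -> (forall x, f x <= 1) ->
  (forall x, x0 <= x -> f x <= C * survival G x) ->
  exists2 C' : R, 0 < C' & forall x, f x <= C' * survival G x.
Proof.
move=> hG C0 f1 fC; have G0 := survival_gt0 x0 hG.
exists (C + (survival G x0)^-1); first by rewrite ltr_wpDl ?invr_gt0.
move=> x; have [x0x|xx0] := leP x0 x.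
  rewrite mulrDl (le_trans (fC x x0x))// lerDl mulr_ge0 ?invr_ge0 ?ltW//.
  exact: survival_gt0.
rewrite mulrDl (le_trans (f1 x))// ler_wpDl ?mulr_ge0 ?survival_ge0//.
by rewrite mulrC ler_pdivlMr// mul1r survival_le// ltW.
Qed.

Lemma tail_le_pointwise F G :
  (forall x, survival F x <= survival G x) -> tail_le F G.
Proof. by move=> FG; exists 1 => // x; rewrite mul1r. Qed.

Lemma tail_le_trans G F H : tail_le F G -> tail_le G H -> tail_le F H.
Proof.
move=> [C C0 FG] [D D0 GH]; exists (C * D) => [|x]; first exact: mulr_gt0.
by rewrite (le_trans (FG x))// -mulrA ler_pM2l.
Qed.

Lemma tail_le_convolution F F' G G' : tail_le F F' -> tail_le G G' ->
  tail_le (convolution F G) (convolution F' G').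
Proof.
move=> [C C0 FF'] [D D0 GG'].
apply: (@tail_le_trans (convolution F' G)).
  by exists C => //; apply: survival_convolution_le_l => //; exact: ltW.
by exists D => //; apply: survival_convolution_le_r => //; exact: ltW.
Qed.

Lemma excess_tail_le F F' G G' : tail_le F F' -> tail_le G G' ->
  exists2 C : R, 0 < C &
    forall K x, excess F G K x <= C * excess F' G' K x.
Proof.
move=> [C C0 FF'] [D D0 GG']; exists (C * D) => [|K x]; first exact: mulr_gt0.
apply: (le_trans (excess_le_l G (ltW C0) FF' K x)).
by rewrite -mulrA ler_pM2l//; apply: excess_le_r => //; exact: ltW.
Qed.

Lemma negligible_excess_tail_le F G H :
  negligible_excess F -> tail_le G F -> tail_le H F ->
  forall eps : R, 0 < eps -> exists K x0 : R, 0 <= K /\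
    forall K' x, K <= K' -> x0 <= x -> excess G H K' x <= eps * survival F x.
Proof.
move=> neF GF HF eps eps0; have [C C0 CE] := excess_tail_le GF HF.
have [K [x0 KE]] := neF (eps / C) (divr_gt0 eps0 C0).
exists (Num.max K 0), x0; split; first by rewrite le_max lexx orbT.
move=> K' x; rewrite ge_max => /andP[KK' _] x0x.
apply: (le_trans (CE K' x)); rewrite -ler_pdivlMl//.
apply: (le_trans (excess_anti F F x KK')); apply: (le_trans (KE x x0x)).
by rewrite mulrA [C^-1 * eps]mulrC.
Qed.

Lemma negligible_excess_equiv F G :
  negligible_excess F -> tail_le F G -> tail_le G F -> negligible_excess G.
Proof.
move=> neF [C C0 FG] GF eps eps0.
have [K [x0 [_ KE]]] := negligible_excess_tail_le neF GF GF (divr_gt0 eps0 C0).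
exists K, x0 => x x0x; apply: (le_trans (KE K x (lexx _) x0x)).
by rewrite mulrAC ler_pdivrMr// -mulrA ler_pM2l// mulrC.
Qed.

(** A bound on the tail of F * F by a shifted tail of F suffices for two
    regularity properties. Since P(X > x - L) P(X > L + K) is at most the tail
    of F * F at x + K, hence at most C P(X > x), shifting the argument of the
    tail costs only a constant; the shift in the assumed bound can then be
    removed. *)
Section shift.
Variables (F : distrFun R) (C K x0 : R).
Hypotheses (hF : nonneg_unbounded F) (C0 : 0 <= C).
Hypothesis (FF_le : forall x, x0 <= x ->
  survival (convolution F F) x <= C * survival F (x - K)).

Lemma survival_shift (L : R) :
  exists2 C' : R, 0 < C' & forall x, survival F (x - L) <= C' * survival F x.
Proof.
have FLK := survival_gt0 (L + K) hF.
apply: (@eventually_tail_le _ _ (C / survival F (L + K)) (x0 - K)) => //.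
- by rewrite divr_ge0// ltW.
- by move=> x; exact: survival_le1.
move=> x x0x; rewrite mulrAC ler_pdivlMr//.
apply: (le_trans (survivalM_le F F _ _)).
have -> : x - L + (L + K) = x + K by ring.
by apply: (le_trans (FF_le _)); rewrite ?addrK// -lerBlDr.
Qed.

Lemma tail_le_convolution_self : tail_le (convolution F F) F.
Proof.
have [C' C'0 shift] := survival_shift K.
apply: (@eventually_tail_le _ _ (C * C') x0) => //.
- by rewrite mulr_ge0// ltW.
- by move=> x; exact: survival_le1.
move=> x x0x; apply: (le_trans (FF_le x0x)).
by rewrite -mulrA ler_wpM2l.
Qed.

End shift.

(** With eps = 1 the three terms of [survival_convolution_split] are each at most
    the tail of F at x - K. *)
Lemma negligible_excess_convolution_le F : nonneg_unbounded F ->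
  negligible_excess F -> exists K x0 : R, forall x, x0 <= x ->
  survival (convolution F F) x <= 3 * survival F (x - K).
Proof.
move=> hF neF; have FF : tail_le F F by exact: tail_le_pointwise.
have [K [x0 [K0 KE]]] := negligible_excess_tail_le neF FF FF ltr01.
exists K, x0 => x x0x; apply: (le_trans (survival_convolution_split F F K x)).
have := KE K x (lexx _) x0x; rewrite mul1r => h.
have : survival F x <= survival F (x - K) by apply: survival_le; rewrite gerBl.
by move: h; lra.
Qed.

Lemma negligible_excess_survival_shift F L : nonneg_unbounded F ->
  negligible_excess F ->
  exists2 C : R, 0 < C & forall x, survival F (x - L) <= C * survival F x.
Proof.
move=> hF /(negligible_excess_convolution_le hF)[K [x0 FF]].
exact: (survival_shift hF _ FF).
Qed.

Lemma negligible_excess_tail_le_convolution F : nonneg_unbounded F ->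
  negligible_excess F -> tail_le (convolution F F) F.
Proof.
move=> hF /(negligible_excess_convolution_le hF)[K [x0 FF]].
exact: (tail_le_convolution_self hF _ FF).
Qed.

Lemma tail_le_convolution_closed F G H : nonneg_unbounded F ->
  negligible_excess F -> tail_le G F -> tail_le H F ->
  tail_le (convolution G H) F.
Proof.
move=> hF neF GF HF; apply: (tail_le_trans (tail_le_convolution GF HF)).
exact: negligible_excess_tail_le_convolution.
Qed.

Lemma nconvolutionS F k :
  nconvolution F k.+2 = convolution F (nconvolution F k.+1).
Proof. by []. Qed.

Lemma nonneg_unbounded_nconvolution F k : nonneg_unbounded F ->
  nonneg_unbounded (nconvolution F k.+1).
Proof.
move=> hF; elim: k => [//|k IH].
by rewrite nconvolutionS; exact: nonneg_unbounded_convolution.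
Qed.

Lemma le_survival_nconvolution F k l x : nonneg_unbounded F -> (k <= l)%N ->
  survival (nconvolution F k.+1) x <= survival (nconvolution F l.+1) x.
Proof.
move=> hF; elim: l => [|l IH]; first by rewrite leqn0 => /eqP ->.
rewrite leq_eqVlt => /orP[/eqP ->//|]; rewrite ltnS => /IH/le_trans; apply.
by rewrite nconvolutionS; exact: le_survival_convolution_r.
Qed.

Lemma tail_le_nconvolution F k : nonneg_unbounded F -> negligible_excess F ->
  tail_le (nconvolution F k.+1) F.
Proof.
move=> hF neF; elim: k => [|k IH]; first exact: tail_le_pointwise.
rewrite nconvolutionS; apply: tail_le_convolution_closed => //.
exact: tail_le_pointwise.
Qed.

(** The converse tail bound needed for taking convolution roots. Let H be the
    law of the n-fold sum. Splitting off one summand at a time, every lower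
    convolution power has a tail that is at most C P(X > x - K) plus an
    arbitrarily small multiple of the tail of H, because its excess over a
    single big jump is dominated by the excess of two copies of H. At the n-th
    power, that small multiple is absorbed on the left. *)
Lemma nconvolution_root_tail_le F n : nonneg_unbounded F ->
  negligible_excess (nconvolution F n.+1) -> tail_le (nconvolution F n.+1) F.
Proof.
move=> hF neH; have hH := nonneg_unbounded_nconvolution n hF.
have sub k : (k <= n)%N ->
    tail_le (nconvolution F k.+1) (nconvolution F n.+1).
  by move=> kn; apply: tail_le_pointwise => x; exact: le_survival_nconvolution.
have shift L := negligible_excess_survival_shift L hH neH.
move: sub shift neH hH; set H := nconvolution F n.+1 => sub shift neH hH.
have {sub} main k (eps : R) : (k <= n)%N -> 0 < eps ->
    exists K C x0 : R, [/\ 0 <= K, 0 <= C & forall x, x0 <= x ->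
      survival (nconvolution F k.+1) x <=
      C * survival F (x - K) + eps * survival H x].
  elim: k eps => [|k IH] eps kn eps0.
    exists 0, 1, 0; split => // x _; rewrite subr0 mul1r lerDl.
    by rewrite mulr_ge0 ?survival_ge0// ltW.
  have e20 : 0 < eps / 2 by rewrite divr_gt0.
  have [K1 [x1 [K10 KE]]] := negligible_excess_tail_le neH
    (sub 0 (leq0n _)) (sub k (ltnW kn)) e20.
  have [C1 C10 shift1] := shift K1.
  have [K2 [C2 [x2 [K20 C20 IH2]]]] := IH _ (ltnW kn) (divr_gt0 e20 C10).
  (* The induction hypothesis is used at x - K1; its error term, of size
     eps / (2 C1), becomes eps / 2 when H is shifted back from x - K1 to x. *)
  exists (K1 + K2), (1 + C2), (Num.max x1 (x2 + K1)); split.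
  - exact: addr_ge0.
  - exact: addr_ge0.
  move=> x; rewrite ge_max => /andP[x1x x2x].
  apply: (le_trans (survival_convolution_split F _ K1 x)).
  have h1 := KE K1 x (lexx _) x1x.
  have h2 : survival (nconvolution F k.+1) (x - K1) <=
      C2 * survival F (x - (K1 + K2)) + eps / 2 * survival H x.
    have x2' : x2 <= x - K1 by rewrite lerBrDr.
    apply: (le_trans (IH2 _ x2')); rewrite opprD addrA lerD2l.
    by rewrite -[leLHS]mulrA ler_pM2l// ler_pdivrMl.
  have h3 : survival F (x - K1) <= survival F (x - (K1 + K2)).
    by apply: survival_le; lra.
  by move: h1 h2 h3; lra.
have [K [C [x0 [K0 C0 HC]]]] := main n (1/2) (leqnn n) ltac:(lra).
have [C1 C10 shift1] := shift K.
apply: (@eventually_tail_le _ _ (C1 * (2 * C)) (x0 - K)) => //.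
- by rewrite mulr_ge0 ?mulr_ge0// ltW.
- by move=> x; exact: survival_le1.
move=> x x0x; have := shift1 (x + K); rewrite addrK => /le_trans; apply.
rewrite -mulrA ler_pM2l//.
have x0' : x0 <= x + K by rewrite -lerBlDr.
by have := HC _ x0'; rewrite addrK -/H; lra.
Qed.

End negligible_excess.

(** * Limits inferior, tail equivalence and big jumps *)

Section limits.
Context (R : realType).
Implicit Types (f : R -> \bar R) (F G : distrFun R).

Lemma le_limf_einf_pinfty f (a : \bar R) (x0 : R) :
  (forall x, x0 <= x -> (a <= f x)%E) -> (a <= limf_einf f +oo%R)%E.
Proof.
move=> af; rewrite limf_einfE.
apply: (@le_trans _ _ (ereal_inf (f @` [set x | x0 < x]))).
  by apply/ereal_infP => _ [x /= /ltW xx0 <-]; exact: af.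
apply: ereal_sup_ubound; exists [set x | x0 < x] => //.
by exists x0; split; [exact: num_real|].
Qed.

Lemma limf_einf_pinfty_le f (b : \bar R) :
  (forall x, (f x <= b)%E) -> (limf_einf f +oo%R <= b)%E.
Proof.
move=> fb; rewrite limf_einfE; apply/ereal_supP => _ [V [M [_ MV]] <-].
apply: le_trans (fb (M + 1)); apply: ereal_inf_lbound; exists (M + 1) => //.
by apply: MV; rewrite ltrDl.
Qed.

Lemma lt_limf_einf_pinfty f (a : \bar R) : (a < limf_einf f +oo%R)%E ->
  exists2 b, (a < b)%E & exists x0 : R, forall x, x0 <= x -> (b <= f x)%E.
Proof.
rewrite limf_einfE => /ereal_sup_gt[_ [V [M [_ MV]] <-] aV].
exists (ereal_inf (f @` V)) => //; exists (M + 1) => x Mx.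
apply: ereal_inf_lbound; exists x => //; apply: MV.
by apply: lt_le_trans Mx; rewrite ltrDl.
Qed.

(** Both tails are positive everywhere, so bounds on their ratio near infinity
    are global two-sided bounds up to constants. *)
Lemma asymp_tail_le F G : nonneg_unbounded F -> nonneg_unbounded G ->
  asymp (survival F) (survival G) <-> tail_le F G /\ tail_le G F.
Proof.
move=> hF hG; have F0 x := survival_gt0 x hF; have G0 x := survival_gt0 x hG.
have ratioE x c : (c%:E <= (survival F x / survival G x)%:E)%E =
    (c * survival G x <= survival F x) by rewrite lee_fin ler_pdivlMr.
have ratioE' x c : ((survival F x / survival G x)%:E <= c%:E)%E =
    (survival F x <= c * survival G x) by rewrite lee_fin ler_pdivrMr.
split=> [[inf0 supoo]|[[C C0 FG] [D D0 GF]]].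
  split.
    have : (-oo < limf_einf
        (fun x => - (survival F x / survival G x)%:E)%E +oo%R)%E.
      by rewrite limf_einfN -lteN2 oppeK.
    move=> /lt_limf_einf_pinfty[b b0 [x0 bx0]].
    have [c [c0 cb]] : exists c : R, 0 < c /\ (- c%:E <= b)%E.
      case: b b0 {bx0} => [r _||//].
        exists (`|r| + 1); split; first by rewrite ltr_wpDl.
        rewrite -EFinN lee_fin lerNl; apply: le_trans (ler_norm _) _.
        by rewrite normrN lerDl.
      by exists 1; rewrite leey.
    apply: (@eventually_tail_le _ _ _ c x0) => //; first exact: ltW.
      by move=> x; exact: survival_le1.
    move=> x x0x; rewrite -ratioE' -leeN2.
    exact: le_trans cb (bx0 x x0x).
  move: inf0 => /lt_limf_einf_pinfty[b b0 [x0 bx0]].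
  have [c c0 cb] : exists2 c : R, 0 < c & (c%:E <= b)%E.
    case: b b0 {bx0} => [r||//]; first by rewrite lte_fin; exists r.
    by exists 1; rewrite ?leey.
  apply: (@eventually_tail_le _ _ _ c^-1 x0) => //.
  - by rewrite invr_ge0 ltW.
  - by move=> x; exact: survival_le1.
  move=> x x0x; rewrite ler_pdivlMl// -ratioE.
  exact: le_trans cb (bx0 x x0x).
split.
  apply: (@lt_le_trans _ _ (D^-1)%:E); first by rewrite lte_fin invr_gt0.
  apply: (@le_limf_einf_pinfty _ _ 0) => x _.
  by rewrite ratioE ler_pdivrMl.
apply: (@le_lt_trans _ _ C%:E); last exact: ltry.
rewrite -leeN2 -limf_einfN.
by apply: (@le_limf_einf_pinfty _ _ 0) => x _; rewrite leeN2 ratioE'.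
Qed.

Lemma cvg_survival F : survival F @ +oo --> (0 : R).
Proof.
rewrite -(subrr 1); apply: cvgB; first exact: cvg_cst.
exact: cumulativey.
Qed.

Lemma survival_small F (eps : R) : 0 < eps -> exists x, survival F x <= eps.
Proof.
move=> eps0; have /cvgrPdist_le/(_ _ eps0)[M [_ FM]] := cvg_survival F.
exists (M + 1); have := FM (M + 1); rewrite ltrDl sub0r normrN => /(_ ltr01).
by rewrite ger0_norm// survival_ge0.
Qed.

End limits.

Lemma bigsetU_ordP (T : Type) (m : nat) (A : 'I_m -> set T) (t : T) :
  (\big[setU/set0]_(i < m) A i) t <-> exists i, A i t.
Proof.
rewrite -bigcup_seq; split => [[i _ Ait]|[i Ait]]; first by exists i.
by exists i => //=; exact: mem_index_enum.
Qed.

Section big_jump.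
Context (R : realType) d (T : measurableType d) (P : probability T R) (m : nat).
Variable X : 'I_m -> {RV P >-> R}.

Definition sum_gt (x : R) : set T := [set t | x < \sum_(i < m) X i t].

(** The event complementary, inside [sum_gt x], to that of a big jump. *)
Definition sum_gt_no_jump (K x : R) : set T :=
  [set t | (forall i, X i t <= x - K) /\ x < \sum_(i < m) X i t].

Lemma measurable_RV_gt (Y : {RV P >-> R}) (x : R) : measurable [set t | x < Y t].
Proof.
have := measurable_funPTI Y (measurable_itv `]x, +oo[).
by congr (measurable _); apply/seteqP; split => t /=; rewrite in_itv/= andbT.
Qed.

Lemma measurable_sum_gt x : measurable (sum_gt x).
Proof.
have mS : measurable_fun setT (fun t => \sum_(i < m) X i t).
  exact: measurable_sum.
have := mS measurableT `]x, +oo[%classic.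
rewrite setTI => /(_ (measurable_itv _)).
by congr (measurable _); apply/seteqP; split => t /=; rewrite in_itv/= andbT.
Qed.

Lemma sum_gt_no_jumpE K x : sum_gt_no_jump K x =
  sum_gt x `\` \big[setU/set0]_(i < m) [set t | x - K < X i t].
Proof.
apply/seteqP; split => t /=.
  move=> [small xt]; split => // /bigsetU_ordP[i /=].
  by rewrite ltNge small.
move=> [xt small]; split => // i; rewrite leNgt; apply/negP => it.
by apply/small/bigsetU_ordP; exists i.
Qed.

Lemma measurable_sum_gt_no_jump K x : measurable (sum_gt_no_jump K x).
Proof.
rewrite sum_gt_no_jumpE; apply: measurableD; first exact: measurable_sum_gt.
by apply: bigsetU_measurable => i _; exact: measurable_RV_gt.
Qed.

Lemma big_jump_ratioE K x : 0 < prob P (sum_gt x) ->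
  big_jump_ratio X K x = 1 - prob P (sum_gt_no_jump K x) / prob P (sum_gt x).
Proof.
move=> S0; set J := \big[setU/set0]_(i < m) [set t | x - K < X i t].
have mJ : measurable J.
  by apply: bigsetU_measurable => i _; exact: measurable_RV_gt.
have -> : big_jump_ratio X K x = prob P (sum_gt x `&` J) / prob P (sum_gt x).
  rewrite /big_jump_ratio prob.unlock; congr (fine (P _) / _).
  apply/seteqP; split => t /= [].
    move=> /bigmax_gtP[//|[i _ it] xt]; split => //.
    by apply/bigsetU_ordP; exists i => //=; rewrite -lte_fin.
  move=> xt /bigsetU_ordP[i /= it]; split => //.
  by apply/bigmax_gtP; right; exists i => //; rewrite lte_fin.
rewrite (prob_setDI P (measurable_sum_gt x) mJ) -sum_gt_no_jumpE in S0 *.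
apply: (mulIf (lt0r_neq0 S0)); rewrite mulrBl !divfK ?lt0r_neq0//; lra.
Qed.

End big_jump.

(** * The class J implies negligible excess *)

Section classJ_negligible_excess.
Context (R : realType).
Implicit Types (F : distrFun R).

(** The ratio is at most 1, so its convergence to 1 only says that the
    conditional probability of having no big jump becomes eventually small. *)
Lemma cvg_big_jump_ratioP d (T : measurableType d) (P : probability T R)
    (m : nat) (X : 'I_m -> {RV P >-> R}) :
  (forall x, 0 < prob P (sum_gt X x)) ->
  (limf_einf (fun x => (big_jump_ratio X K x)%:E) +oo%R @[K --> +oo%R]
    --> 1%:E) <->
  (forall eps : R, 0 < eps -> exists K0 : R, forall K, K0 <= K ->
    exists x0 : R, forall x, x0 <= x ->
      prob P (sum_gt_no_jump X K x) <= eps * prob P (sum_gt X x)).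
Proof.
move=> S0; set L := fun K => limf_einf _ _.
have ratio_ge K x eps : ((1 - eps)%:E <= (big_jump_ratio X K x)%:E)%E =
    (prob P (sum_gt_no_jump X K x) <= eps * prob P (sum_gt X x)).
  by rewrite lee_fin big_jump_ratioE// lerD2l lerN2 ler_pdivrMr.
split=> [L1 eps eps0|JX].
  have nbhs1 : nbhs 1%:E (fun u : \bar R => ((1 - eps)%:E < u)%E).
    by apply: open_ereal_gt'; rewrite lte_fin ltrBlDr ltrDl.
  have [M [_ LM]] := L1 _ nbhs1.
  exists (M + 1) => K MK.
  have /lt_limf_einf_pinfty[b eb [x0 bx0]] : ((1 - eps)%:E < L K)%E.
    by apply: LM; apply: lt_le_trans MK; rewrite ltrDl.
  exists x0 => x x0x; rewrite -ratio_ge.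
  exact: le_trans (ltW eb) (bx0 x x0x).
have L1 K : (L K <= 1%:E)%E.
  apply: limf_einf_pinfty_le => x; rewrite lee_fin big_jump_ratioE//.
  by rewrite gerBl divr_ge0// prob_ge0.
move=> A nA.
have /nbhs_ballP[e /= e0 eA] : nbhs (1 : R) (fun r => A r%:E) := nA.
have [K0 JK] := JX (e / 2) (divr_gt0 e0 (ltr0n _ 2)).
exists K0; split => [|K /ltW K0K]; first exact: num_real.
have [x0 JK0] := JK K K0K.
have : ((1 - e / 2)%:E <= L K)%E.
  by apply: (@le_limf_einf_pinfty _ _ _ x0) => x x0x; rewrite ratio_ge JK0.
rewrite /=; move: (L1 K); case: (L K) => [r||]//=.
rewrite !lee_fin => r1 er; apply: eA; rewrite /ball/= ger0_norm ?subr_ge0//.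
by move: r1 er e0; lra.
Qed.

Section pair.
Variable F : distrFun R.
Let T := (measurableTypeR R * measurableTypeR R)%type.

(** Two independent copies of F realised as the coordinates of the plane; they
    are the family to which the definition of the class J is applied. *)
Definition coord (i : 'I_2) (z : T) : R := if i == ord0 then z.1 else z.2.

Lemma measurable_coord i : measurable_fun setT (coord i).
Proof.
by rewrite /coord; case: (i == ord0); [exact: measurable_fst|exact: measurable_snd].
Qed.

HB.instance Definition _ i :=
  isMeasurableFun.Build _ _ _ _ (coord i) (measurable_coord i).

Definition coordRV (i : 'I_2) : {RV (law2 F F) >-> R} := coord i.

Lemma law2_coordRV i (A : set (measurableTypeR R)) : measurable A ->
  law2 F F (coordRV i @^-1` A) = df_law F A.
Proof.
move=> mA; have [i0|i0] := eqVneq i ord0.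
  have -> : coordRV i @^-1` A = A `*` setT.
    by apply/seteqP; split => z; rewrite /= /coord i0 eqxx //= => -[].
  by rewrite law2XE// [X in (_ * X)%E]probability_setT mule1.
have -> : coordRV i @^-1` A = setT `*` A.
  by apply/seteqP; split => z; rewrite /= /coord (negbTE i0) //= => -[].
by rewrite law2XE// [X in (X * _)%E]probability_setT mul1e.
Qed.

Lemma iid_coordRV : iid coordRV F.
Proof.
split=> [i x|A mA].
  by rewrite /cdf /distribution /pushforward law2_coordRV// df_law_itvNyc.
have -> : \bigcap_i (coordRV i @^-1` A i) = A ord0 `*` A ord_max.
  apply/seteqP; split => z /=.
    by move=> Az; split; [exact: (Az ord0)|exact: (Az ord_max)].
  move=> [A0 A1] i _ /=; rewrite /coord; case: (eqVneq i ord0) => [->//|].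
  case: i => [[|[|//]] i2] // _.
  by rewrite (_ : Ordinal i2 = ord_max)//; exact/val_inj.
rewrite big_ord_recl big_ord1 !(law2_coordRV _ (mA _)).
rewrite (_ : lift ord0 ord0 = ord_max :> 'I_2); last exact/val_inj.
exact: (law2XE F F (mA ord0) (mA ord_max)).
Qed.

Lemma sum_gt_coordRV x : sum_gt coordRV x = [set z | x < z.1 + z.2].
Proof. by apply/seteqP; split => z; rewrite /sum_gt/= big_ord_recl big_ord1. Qed.

Lemma sum_gt_no_jump_coordRV K x : sum_gt_no_jump coordRV K x =
  [set z | [/\ z.1 <= x - K, z.2 <= x - K & x < z.1 + z.2]].
Proof.
apply/seteqP; split => z; rewrite /sum_gt_no_jump/= big_ord_recl big_ord1.
  by move=> [small xz]; split; [exact: (small ord0)|exact: (small ord_max)|].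
move=> [z1 z2 xz]; split => // i; rewrite /coordRV/= /coord.
by case: ifP.
Qed.

End pair.

(** The case m = 2 suffices. A sum without big jump has conditional probability
    at most 1/2 for a suitable K, so the tail of F * F at x is at most
    4 P(X > x - K), and the lemmas on shifts apply. If both summands exceed K2
    and their sum exceeds x, either there is no big jump beyond x - K1, which is
    rare by hypothesis, or one summand exceeds x - K1 while the other exceeds
    K2; the latter has probability at most C P(X > x) P(X > K2). *)
Lemma classJ_negligible_excess F : classJ F -> negligible_excess F.
Proof.
move=> [hF /(_ 2 (leqnn _) _ _ _ _ (iid_coordRV F))].
set X := coordRV F; set P := law2 F F.
have SE x : prob P (sum_gt X x) = survival (convolution F F) x.
  by rewrite sum_gt_coordRV -survival_convolution.
have hFF := nonneg_unbounded_convolution hF hF.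
move=> /cvg_big_jump_ratioP.
have S0 x : 0 < prob P (sum_gt X x) by rewrite SE; exact: survival_gt0.
move=> /(_ S0) J.
have D_le K x : prob P (sum_gt X x) <=
    2 * survival F (x - K) + prob P (sum_gt_no_jump X K x).
  rewrite mulr_natl mulr2n -{1}(law2_fst_gt F F) -(law2_snd_gt F F).
  have m1 := measurable_fst_gt (x - K); have m2 := measurable_snd_gt (x - K).
  have m3 := measurable_sum_gt_no_jump X K x.
  apply: le_trans (lerD (prob_setU_le _ m1 m2) (lexx _)).
  apply: le_trans (prob_setU_le _ _ m3); last exact: measurableU.
  apply: le_prob; [exact: measurable_sum_gt| |].
    by apply: measurableU => //; exact: measurableU.
  rewrite sum_gt_coordRV sum_gt_no_jump_coordRV => z /= xz.
  have [?|z1] := ltP (x - K) z.1; first by left; left.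
  have [?|z2] := ltP (x - K) z.2; first by left; right.
  by right.
have {D_le} [K [x0 FF_le]] : exists K x0 : R, forall x, x0 <= x ->
    survival (convolution F F) x <= 4 * survival F (x - K).
  have [K JK] := J (1/2) ltac:(lra); have [x0 JK0] := JK K (lexx _).
  exists K, x0 => x x0x; have := JK0 x x0x; have := D_le K x.
  by rewrite SE; lra.
have [C C0 FFC] := tail_le_convolution_self hF (ler0n _ 4) FF_le.
move=> eps eps0.
have [K1 JK1] := J _ (divr_gt0 (divr_gt0 eps0 (ltr0n _ 2)) C0).
have [x1 {JK1}J1] := JK1 K1 (lexx _).
have [C1 C10 shift] := survival_shift hF (ler0n _ 4) FF_le K1.
(* C1 is the cost of the shift by K1; the two events in which one summand is
   big contribute eps / 4 each. *)
have [K2 K2E] := survival_small F (divr_gt0 eps0 (mulr_gt0 (ltr0n _ 4) C10)).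
exists K2, x1 => x x1x.
pose B1 := [set z : measurableTypeR R * measurableTypeR R | x - K1 < z.1] `&`
  [set z | K2 < z.2].
pose B2 := [set z : measurableTypeR R * measurableTypeR R | K2 < z.1] `&`
  [set z | x - K1 < z.2].
have mB1 : measurable B1.
  by apply: measurableI; [exact: measurable_fst_gt|exact: measurable_snd_gt].
have mB2 : measurable B2.
  by apply: measurableI; [exact: measurable_fst_gt|exact: measurable_snd_gt].
have m3 := measurable_sum_gt_no_jump X K1 x.
have h0 : excess F F K2 x <=
    prob P B1 + prob P B2 + prob P (sum_gt_no_jump X K1 x).
  apply: le_trans (lerD (prob_setU_le _ mB1 mB2) (lexx _)).
  apply: le_trans (prob_setU_le _ _ m3); last exact: measurableU.
  apply: le_prob; [exact: measurable_both_big| |].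
    by apply: measurableU => //; exact: measurableU.
  rewrite sum_gt_no_jump_coordRV => z /= [K2z1 K2z2 xz].
  have [?|z1] := ltP (x - K1) z.1; first by left; left.
  have [?|z2] := ltP (x - K1) z.2; first by left; right.
  by right.
have rect a b : prob P ([set z | a < z.1] `&` [set z | b < z.2]) =
    survival F a * survival F b.
  rewrite !survivalE -law2X//; congr (prob _ _).
  by apply/seteqP; split => z /=; rewrite !in_itv/= !andbT.
move: h0; rewrite !rect [survival F K2 * _]mulrC => h0.
have h1 : prob P (sum_gt_no_jump X K1 x) <= eps / 2 * survival F x.
  apply: (le_trans (J1 x x1x)); rewrite SE.
  by rewrite -[leLHS]mulrA ler_pM2l ?divr_gt0// ler_pdivrMl.
have h2 : survival F (x - K1) * survival F K2 <= eps / 4 * survival F x.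
  have -> : eps / 4 * survival F x =
      (C1 * survival F x) * (eps / (4 * C1)).
    by field; rewrite lt0r_neq0.
  by apply: ler_pM => //; exact: survival_ge0.
by move: h0 h1 h2; lra.
Qed.

End classJ_negligible_excess.

(** * Partial sums of independent variables *)

Section independent_sums.
Context (R : realType) d (T : measurableType d) (P : probability T R) (m : nat).
Variables (X : 'I_m -> {RV P >-> R}) (F : distrFun R).
Hypothesis iidX : iid X F.

Lemma measurable_RV_preimage (Y : {RV P >-> R}) (A : set (measurableTypeR R)) :
  measurable A -> measurable (Y @^-1` A).
Proof. exact: (measurable_funPTI Y). Qed.

Lemma measurable_RV (Y : {RV P >-> R}) :
  measurable_fun setT (Y : T -> measurableTypeR R).
Proof. by move=> _ A mA; rewrite setTI; exact: measurable_RV_preimage. Qed.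

(** A random variable with codomain seen as the measurable space that carries
    [df_law F]. *)
Definition borelRV (Y : {RV P >-> R}) : T -> measurableTypeR R := Y.

HB.instance Definition _ (Y : {RV P >-> R}) :=
  isMeasurableFun.Build _ _ _ _ (borelRV Y) (measurable_RV Y).

Lemma iid_law i (A : set (measurableTypeR R)) : measurable A ->
  P (X i @^-1` A) = df_law F A.
Proof.
move=> mA; apply/esym.
pose Xi : {mfun T >-> measurableTypeR R} := borelRV (X i).
have law := @df_law_unique _ F (distribution P Xi) (iidX.1 i).
exact: law.
Qed.

Definition psum (s : seq 'I_m) (t : T) : R := \sum_(j <- s) X j t.

Definition others_in (s : seq 'I_m) (A : 'I_m -> set (measurableTypeR R)) :
    set T := \bigcap_(j in [set j | j \notin s]) (X j @^-1` A j).

(** A partial sum has law V and is independent of all the remaining variables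
    jointly. Carrying the remaining variables along is what lets the next one be
    added to the sum by induction. *)
Definition psum_indep (s : seq 'I_m) (V : distrFun R) :=
  forall (B : set (measurableTypeR R)) (A : 'I_m -> set (measurableTypeR R)),
    measurable B -> (forall i, measurable (A i)) ->
    prob P (psum s @^-1` B `&` others_in s A) =
    prob (df_law V) B * \prod_(j | j \notin s) prob (df_law F) (A j).

Lemma measurable_psum s : measurable_fun setT (psum s : T -> measurableTypeR R).
Proof. exact: measurable_sum. Qed.

Lemma measurable_others_in s A : (forall i, measurable (A i)) ->
  measurable (others_in s A).
Proof.
move=> mA; apply: fin_bigcap_measurable => [|j _]; first exact: finite_finset.
exact: measurable_RV_preimage.
Qed.

Lemma psum_indep1 i : psum_indep [:: i] F.
Proof.
move=> B A mB mA; pose A' j := if j == i then B else A j.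
have mA' j : measurable (A' j) by rewrite /A'; case: eqP.
have -> : psum [:: i] @^-1` B `&` others_in [:: i] A = \bigcap_j (X j @^-1` A' j).
  apply/seteqP; split => t; rewrite /psum/= big_seq1.
    move=> [Bt At] j _ /=; rewrite /A'; case: eqP => [->//|/eqP ji].
    by apply: At => /=; rewrite inE.
  move=> At; split; first by have := At i I; rewrite /A'/= eqxx.
  by move=> j /=; rewrite inE => ji; have := At j I; rewrite /A'/= (negbTE ji).
apply: EFin_inj; rewrite probE; last first.
  apply: fin_bigcap_measurable => [|j _]; first exact: finite_finset.
  exact: measurable_RV_preimage.
rewrite (iidX.2 A' mA') (eq_bigr (fun j => (prob (df_law F) (A' j))%:E)); last first.
  by move=> j _; rewrite probE// iid_law.
rewrite prodEFin; congr EFin; rewrite (bigD1 i)//= {1}/A' eqxx; congr *%R.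
apply: eq_big => j; first by rewrite inE.
by rewrite /A' => /negbTE ->.
Qed.

Lemma measurable_RV_psum (i : 'I_m) (s : seq 'I_m) :
  measurable_fun setT ((fun t => (X i t, psum s t)) :
    T -> (measurableTypeR R * measurableTypeR R)%type).
Proof.
by apply: measurable_fun_pair; [exact: measurable_RV|exact: measurable_psum].
Qed.

(** For fixed events on the other variables, both sides are finite measures in Z
    that agree on rectangles, hence agree everywhere. Taking Z to be a half-plane
    adds X i to the sum; taking all of the others as s gives the joint law of one
    variable and the rest of the sum. *)
Lemma psum_indep_pair (i : 'I_m) (s : seq 'I_m) (V : distrFun R) : i \notin s -> psum_indep s V ->
  forall (Z : set (measurableTypeR R * measurableTypeR R))
    (A : 'I_m -> set (measurableTypeR R)),
    measurable Z -> (forall j, measurable (A j)) ->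
    prob P ((fun t => (X i t, psum s t)) @^-1` Z `&` others_in (i :: s) A) =
    prob (law2 F V) Z * \prod_(j | j \notin i :: s) prob (df_law F) (A j).
Proof.
move=> is_ sV Z A mZ mA; set c := \prod_(j | _) _.
have c0 : 0 <= c by apply: prodr_ge0 => j _; exact: prob_ge0.
have mE := measurable_others_in (i :: s) mA.
pose f (t : T) : measurableTypeR R * measurableTypeR R := (X i t, psum s t).
have mf : measurable_fun setT f := measurable_RV_psum i s.
have mfE Y : measurable Y -> measurable (f @^-1` Y `&` others_in (i :: s) A).
  move=> mY; apply: measurableI => //.
  by rewrite -[X in measurable X]setTI; exact: mf.
pose nu := pushforward (mrestr P mE) f.
pose cV := mscale (NngNum c0) (df_law V).
have uniq := @product_measure_unique _ _ _ _ _ (df_law F) cV nu.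
have nuE : (df_law F \x cV)%E Z = nu Z.
  apply: (uniq mf) => // C B mC mB.
  (* On a rectangle, the condition on X i joins those on the other variables
     outside s, where the hypothesis on s applies. *)
  pose A' j := if j == i then C else A j.
  have mA' j : measurable (A' j) by rewrite /A'; case: eqP.
  have rect : f @^-1` (C `*` B) `&` others_in (i :: s) A =
      psum s @^-1` B `&` others_in s A'.
    apply/seteqP; split => t /=.
      move=> [[Ct Bt] At]; split => // j /= js; rewrite /A'.
      by case: eqP => [->//|/eqP ji]; apply: At; rewrite /= inE negb_or ji.
    move=> [Bt At]; split.
      by split => //; have := At i is_; rewrite /A'/= eqxx.
    move=> j /=; rewrite inE negb_or => /andP[ji js].
    by have := At j js; rewrite /A'/= (negbTE ji).
  transitivity (prob P (psum s @^-1` B `&` others_in s A'))%:E.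
    by rewrite -rect probE//; apply: mfE; exact: measurableX.
  rewrite sV// (bigD1 i)//= {1}/A' eqxx.
  rewrite (eq_big (fun j => j \notin i :: s) (fun j => prob (df_law F) (A j))).
  - by rewrite -/c mulrCA EFinM EFinM !probE// [(df_law V B * _)%E]muleC.
  - by move=> j; rewrite inE negb_or andbC.
  - by move=> j /andP[_ /negbTE ji]; rewrite /A' ji.
transitivity (fine (nu Z)); first by rewrite prob.unlock.
apply: EFin_inj; rewrite -nuE mulrC EFinM probE// law2_xsectionE.
have mV := measurable_fun_xsection (df_law V) mZ.
have -> : (df_law F \x cV)%E Z =
    (c%:E * \int[df_law F]_x df_law V (xsection Z x))%E.
  by rewrite -ge0_integralZl//; exact: mV.
rewrite fineK// fin_numM// -law2_xsectionE -probE//.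
Qed.

Lemma psum_indep_cons (i : 'I_m) (s : seq 'I_m) (V : distrFun R) :
  i \notin s -> psum_indep s V -> psum_indep (i :: s) (convolution F V).
Proof.
move=> is_ sV B A mB mA.
have mB' : measurable (@addRR R @^-1` B).
  by rewrite -[X in measurable X]setTI; exact: measurable_addRR.
have -> : prob (df_law (convolution F V)) B = prob (law2 F V) (@addRR R @^-1` B).
  by rewrite prob.unlock df_law_convolution.
rewrite -(psum_indep_pair is_ sV mB' mA).
by congr (prob P (_ `&` _)); apply/seteqP; split => t; rewrite /psum/= big_cons.
Qed.

Lemma psum_indep_nconvolution k (s : seq 'I_m) : uniq s -> size s = k.+1 ->
  psum_indep s (nconvolution F k.+1).
Proof.
elim: k s => [|k IH] [|i s]//=.
  by move=> _ [/size0nil ->]; exact: psum_indep1.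
by move=> /andP[is_ us] [sk]; apply: psum_indep_cons => //; exact: IH.
Qed.

End independent_sums.

(** * Negligible excess implies the class J *)

Section negligible_excess_classJ.
Context (R : realType).
Implicit Types (F G : distrFun R).

Definition all_but (m : nat) (i : 'I_m) : seq 'I_m := rem i (enum 'I_m).

Lemma iid_split F d (T : measurableType d) (P : probability T R) (k : nat)
    (X : 'I_k.+2 -> {RV P >-> R}) (i : 'I_k.+2) : iid X F ->
  forall Z : set (measurableTypeR R * measurableTypeR R), measurable Z ->
  prob P ((fun t => (X i t, psum X (all_but i) t)) @^-1` Z) =
  prob (law2 F (nconvolution F k.+1)) Z.
Proof.
move=> iidX Z mZ; have us := rem_uniq i (enum_uniq 'I_k.+2).
have sz : size (all_but i) = k.+1.
  by rewrite size_rem ?mem_enum// size_enum_ord.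
have is_ : i \notin all_but i by rewrite mem_rem_uniq ?enum_uniq// inE eqxx.
have all_in j : j \in i :: all_but i.
  by rewrite inE mem_rem_uniq ?enum_uniq// inE/= mem_enum andbT; case: eqP.
have := psum_indep_pair is_ (psum_indep_nconvolution iidX us sz) mZ
  (fun=> measurableT).
rewrite big_pred0 ?mulr1 => [<-|j]; last by rewrite all_in.
congr (prob P _); rewrite -[LHS]setIT; congr (_ `&` _).
by apply/seteqP; split => t //= _ j /=; rewrite all_in.
Qed.

Lemma psum_all_but (m : nat) d (T : measurableType d) (P : probability T R)
    (X : 'I_m -> {RV P >-> R}) (i : 'I_m) t :
  \sum_(j < m) X j t = X i t + psum X (all_but i) t.
Proof. by rewrite -big_enum (big_rem i)//= mem_enum. Qed.

(** Suppose that X_1 + ... + X_m > x with all X_i at most x - K, and x >= m K.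
    Some X_i exceeds x / m >= K, and the rest of the sum exceeds x - X_i >= K.
    The pair formed by X_i and that rest is independent, and the rest has a tail
    dominated by that of F, so the excess is negligible for each of the m
    choices of i. *)
Lemma negligible_excess_classJ F : nonneg_unbounded F -> negligible_excess F ->
  classJ F.
Proof.
move=> hF neF; split=> // -[|[|k]]// _ d T P X iidX.
set m := k.+2 in X iidX *; set V := nconvolution F k.+1.
have hV : nonneg_unbounded V := nonneg_unbounded_nconvolution k hF.
have S_ge x : survival F x <= prob P (sum_gt X x).
  apply: (le_trans (le_survival_convolution_l F x hV)).
  rewrite survival_convolution -(iid_split ord0 iidX (measurable_add_gt x)).
  rewrite le_eqVlt; apply/orP; left; apply/eqP; congr (prob P _).
  by apply/seteqP; split => t; rewrite /sum_gt/= (psum_all_but _ ord0).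
apply/cvg_big_jump_ratioP => [x|eps eps0].
  exact: lt_le_trans (survival_gt0 x hF) (S_ge x).
have m0 : 0 < m%:R :> R by rewrite ltr0n.
have [K [x0 [K0 KE]]] := negligible_excess_tail_le neF
  (tail_le_pointwise (fun x => lexx _)) (tail_le_nconvolution k hF neF)
  (divr_gt0 eps0 m0).
exists K => K' KK'; exists (Num.max x0 (m%:R * K')) => x.
rewrite ge_max => /andP[x0x mKx].
pose B i := (fun t => (X i t, psum X (all_but i) t)) @^-1` both_big K' x.
have mB i : measurable (B i).
  rewrite -[X in measurable X]setTI; apply: measurable_RV_psum => //.
  exact: measurable_both_big.
have sub : sum_gt_no_jump X K' x `<=` \big[setU/set0]_(i < m) B i.
  move=> t [small xt]; apply/bigsetU_ordP.
  have [i Ki] : exists i, K' < X i t.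
    apply: contrapT => /forallNP big; move: xt; apply/negP; rewrite -leNgt.
    apply: le_trans mKx; rewrite mulr_natl -[X in _ *+ X](card_ord m) -sumr_const.
    by apply: ler_sum => i _; rewrite leNgt; apply/negP/big.
  exists i; move: xt (small i); rewrite (psum_all_but _ i) => xt Xi.
  by split => //=; lra.
apply: (le_trans (le_prob _ _ _ sub)).
- exact: measurable_sum_gt_no_jump.
- exact: bigsetU_measurable.
apply: (le_trans (prob_bigsetU_le _ _ mB)).
apply: (@le_trans _ _ (\sum_(i < m) (eps / m%:R * survival F x))).
  apply: ler_sum => i _; rewrite /B (iid_split i iidX (measurable_both_big K' x)).
  exact: KE.
rewrite sumr_const card_ord -[leLHS]mulr_natr mulrAC divfK ?lt0r_neq0//.
by rewrite ler_pM2l.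
Qed.

Lemma classJ_tail_equiv F G : nonneg_unbounded G ->
  negligible_excess F -> tail_le F G -> tail_le G F -> classJ G.
Proof.
move=> hG neF FG GF; apply: negligible_excess_classJ => //.
exact: negligible_excess_equiv FG GF.
Qed.

End negligible_excess_classJ.

(** * Closure properties of the class J *)

Theorem proposition10 (R : realType) (F G : distrFun R) (n : nat)
    (hF : nonneg_unbounded F) (hG : nonneg_unbounded G) (hn : (1 <= n)%N) :
  (classJ F -> asymp (survival F) (survival (nconvolution F n)) /\ classJ (nconvolution F n)) /\
  (classJ F -> asymp (survival F) (survival G) -> classJ (convolution F G)) /\
  (classJ (nconvolution F n) ->
     asymp (survival F) (survival (nconvolution F n)) /\ classJ F).
Proof.
case: n hn => // k _.
have hFn := nonneg_unbounded_nconvolution k hF.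
have F_Fn : tail_le F (nconvolution F k.+1).
  by apply: tail_le_pointwise => x; exact: (@le_survival_nconvolution _ _ 0).
split; [|split].
- move=> /classJ_negligible_excess neF.
  have Fn_F := tail_le_nconvolution k hF neF.
  by split; [exact/asymp_tail_le|exact: classJ_tail_equiv F_Fn Fn_F].
- move=> /classJ_negligible_excess neF /(asymp_tail_le hF hG)[_ GF].
  apply: (@classJ_tail_equiv _ F) => //.
  + exact: nonneg_unbounded_convolution.
  + by apply: tail_le_pointwise => x; exact: le_survival_convolution_l.
  + by apply: tail_le_convolution_closed => //; exact: tail_le_pointwise.
- move=> /classJ_negligible_excess neFn.
  have Fn_F := nconvolution_root_tail_le hF neFn.
  by split; [exact/asymp_tail_le|exact: classJ_tail_equiv Fn_F F_Fn].
Qed.
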